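(* Let $(X,d,G)$ be a $G$-system. Then for every tempered two-sided Følner sequence $\{F_n\}$ of $G$, $$\overline{\mathrm{mdim}}_M(G,X,d)=\max_{x\in X}\overline{\mathrm{mdim}}_M(x,\{F_n\},d)=\max_{\mu\in M(X,G)}\int\overline{\mathrm{mdim}}_M(x,\{F_n\},d)\,d\mu(x).$$
   Context: $G$ is a countably infinite discrete amenable group; a $G$-system $(X,d,G)$ is a compact metric space with a continuous $G$-action by homeomorphisms. A Følner sequence $\{F_n\}$: nonempty finite sets with $|gF_n\triangle F_n|/|F_n|\to0$ for all $g$; two-sided if also $|F_ng\triangle F_n|/|F_n|\to0$ for all $g$; tempered if $|\bigcup_{j<n}F_j^{-1}F_n|\le C|F_n|$ for some $C>0$ and all $n$. $d_F(x,y)=\max_{g\in F}d(gx,gy)$. For nonempty $Z\subset X$, $s(Z,d_F,\epsilon)$ is the maximal cardinality of a subset of $Z$ whose distinct points have $d_F$-distance $>\epsilon$; $h_{top}(G,Z,d,\{F_n\},\epsilon)=\limsup_n\frac1{|F_n|}\log s(Z,d_{F_n},\epsilon)$; $\overline{\mathrm{mdim}}_M(G,Z,\{F_n\},d)=\limsup_{\epsilon\to0}h_{top}(G,Z,d,\{F_n\},\epsilon)/\log\frac1\epsilon$, and $\overline{\mathrm{mdim}}_M(G,X,d)$ denotes this for $Z=X$. The local upper metric mean dimension of $x\in X$ is $\overline{\mathrm{mdim}}_M(x,\{F_n\},d)=\inf_K\overline{\mathrm{mdim}}_M(G,K,\{F_n\},d)$, the infimum over all closed neighborhoods $K$ of $x$.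 $M(X,G)$ is the set of $G$-invariant Borel probability measures. *)

(* Defs.v *)
From HB Require Import structures.
From mathcomp Require Import all_boot all_order all_algebra.
From mathcomp Require Import finmap.
From mathcomp Require Import all_classical all_reals all_analysis.

Set Implicit Arguments.
Unset Strict Implicit.
Unset Printing Implicit Defensive.

Import Order.TTheory GRing.Theory Num.Theory numFieldNormedType.Exports.
Local Open Scope classical_set_scope.
Local Open Scope ring_scope.

Section MeanDim.
Context {R : realType}.

Definition is_group {G : Type} (mul : G -> G -> G) (one : G) (inv : G -> G) : Prop :=
  [/\ (forall a b c, mul a (mul b c) = mul (mul a b) c),
      (forall a, mul one a = a) &
      (forall a, mul (inv a) a = one)].

Definition is_action {G X : Type} (mul : G -> G -> G) (one : G) (act : G -> X -> X) : Prop :=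
  (forall x, act one x = x) /\ (forall g h x, act (mul g h) x = act g (act h x)).

Definition metric_for {X : pseudoPMetricType R} (d : X -> X -> R) : Prop :=
  [/\ (forall x y, d x y = 0 <-> x = y),
      (forall x y, d x y = d y x),
      (forall x y z, d x z <= d x y + d y z) &
      (forall x (e : R), 0 < e -> ball x e = [set y | d x y < e])].

Definition fsymdiff {G : choiceType} (A B : {fset G}) : {fset G} :=
  fsetU (fsetD A B) (fsetD B A).

Definition lmulF {G : choiceType} (mul : G -> G -> G) (g : G) (A : {fset G}) : {fset G} :=
  [fset mul g h | h in A]%fset.

Definition rmulF {G : choiceType} (mul : G -> G -> G) (A : {fset G}) (g : G) : {fset G} :=
  [fset mul h g | h in A]%fset.

Definition Folner {G : choiceType} (mul : G -> G -> G) (F : nat -> {fset G}) : Prop :=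
  (forall n, F n != fset0) /\
  forall g : G, (fun n => (#|` fsymdiff (lmulF mul g (F n)) (F n)|%:R
                           / #|` F n|%:R : R)) @ \oo --> (0 : R).

Definition two_sided_Folner {G : choiceType} (mul : G -> G -> G) (F : nat -> {fset G}) : Prop :=
  Folner mul F /\
  forall g : G, (fun n => (#|` fsymdiff (rmulF mul (F n) g) (F n)|%:R
                           / #|` F n|%:R : R)) @ \oo --> (0 : R).

Definition tempered {G : choiceType} (mul : G -> G -> G) (inv : G -> G)
    (F : nat -> {fset G}) : Prop :=
  exists C : R, 0 < C /\ forall n : nat,
    (#|` \big[@fsetU _/fset0]_(j < n) [fset mul (inv a) b | a in F j, b in F n]%fset |%:R
       <= C * #|` F n|%:R).

Section Mdim.
Context {G : choiceType} {X : pseudoPMetricType R}.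
Variables (act : G -> X -> X) (d : X -> X -> R) (F : nat -> {fset G}).

(* d_A(x,y) = max_{g in A} d(gx,gy)  (A nonempty, d >= 0) *)
Definition dF (A : {fset G}) (x y : X) : R :=
  \big[Num.max/0]_(g <- A) d (act g x) (act g y).

Definition sep_num (Z : set X) (dd : X -> X -> R) (eps : R) : \bar R :=
  ereal_sup [set (#|` E|%:R)%:E | E in
    [set E : {fset X} | [set` E] `<=` Z /\
       {in E &, forall x y, x != y -> eps < dd x y}]].

Definition eln (s : \bar R) : \bar R :=
  match s with
  | r%:E => (ln r)%:E
  | +oo%E => +oo%E
  | -oo%E => -oo%E
  end.

Definition htop (Z : set X) (eps : R) : \bar R :=
  limn_esup (fun n => (eln (sep_num Z (dF (F n)) eps) * ((#|` F n|%:R)^-1)%:E)%E).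

Definition mdimM (Z : set X) : \bar R :=
  limf_esup (fun eps : R => (htop Z eps * ((ln (eps^-1))^-1)%:E)%E) (0^'+).

Definition mdim_loc (x : X) : \bar R :=
  ereal_inf [set mdimM K | K in [set K : set X | closed K /\ nbhs x K]].

End Mdim.

End MeanDim.

Notation borel X := (g_sigma_algebraType (@open X)).

Definition invariant_measure {R : realType} {G : Type} {X : ptopologicalType}
    (act : G -> X -> X) (mu : set (borel X) -> \bar R) : Prop :=
  forall (g : G) (A : set (borel X)), @measurable _ (borel X) A ->
    mu ((act g : borel X -> borel X) @^-1` A) = mu A.

(* Main.v *)
(** The quantity [mdimM] of a union of two sets is the maximum of the two values:
    the factor 2 in the count of separated sets disappears after division by
    [ln (1 / eps)].  By compactness, if every point had a neighbourhood with
    [mdimM] below [D], so would [X]; hence some point has local value [D].  The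
    local value is upper semicontinuous, and it is [G]-invariant because
    [d_{F_n}(g x, g y) = d_{F_n g}(x, y)] and [F_n g] differs from [F_n] by a
    proportion of elements tending to 0, which costs a subexponential factor in
    the count of separated sets.  So [{x | mdim_loc x = D}] is a nonempty closed
    invariant set, and it remains to find an invariant measure on it.  Limits
    along an ultrafilter of the visit frequencies of an orbit in this set give an
    invariant finitely additive probability on all subsets of [X]; its inner
    regularization by closed sets on open sets, followed by outer regularization,
    is an invariant Borel measure by Caratheodory's theorem. *)
Require Import Defs.
From HB Require Import structures.
From mathcomp Require Import all_boot all_order all_algebra.
From mathcomp Require Import finmap.
From mathcomp Require Import all_classical all_reals all_analysis measurable_realfun.
Import Order.TTheory GRing.Theory Num.Theory numFieldNormedType.Exports.
Local Open Scope classical_set_scope.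
Local Open Scope ring_scope.

(** * Finitely additive probabilities and their contents *)

Definition finadd_probability {R : realType} {X : Type} (m : set X -> R) : Prop :=
  [/\ (forall A, 0 <= m A),
      (forall A B, A `&` B = set0 -> m (A `|` B) = m A + m B) &
      m [set: X] = 1].

(** Countable additivity is not assumed of [m]. Passing to closed subsets gives, on open sets of a
    compact normal space, a countably subadditive content, which [outer_content] extends to all
    sets. *)
Definition inner_content {R : realType} {X : topologicalType}
    (m : set X -> R) (U : set X) : \bar R :=
  ereal_sup [set (m K)%:E | K in [set K | closed K /\ K `<=` U]].

Definition outer_content {R : realType} {X : topologicalType}
    (m : set X -> R) (A : set X) : \bar R :=
  ereal_inf [set inner_content m U | U in [set U | open U /\ A `<=` U]].

Lemma finadd_set0 (R : realType) (X : Type) (m : set X -> R) :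
  finadd_probability m -> m set0 = 0.
Proof.
move=> [_ mU _]; have := mU set0 set0 (setI0 _); rewrite setU0.
by move=> /eqP; rewrite eq_sym -subr_eq0 addrK => /eqP.
Qed.

Lemma finadd_le (R : realType) (X : Type) (m : set X -> R) (A B : set X) :
  finadd_probability m -> A `<=` B -> m A <= m B.
Proof.
move=> [m0 mU _] AB; rewrite -(setDUK AB) mU ?lerDl//.
by rewrite setDE setICA setICr setI0.
Qed.

Lemma finadd_subadditive (R : realType) (X : Type) (m : set X -> R) (A B : set X) :
  finadd_probability m -> m (A `|` B) <= m A + m B.
Proof.
move=> mm; have [m0 mU _] := mm.
have -> : A `|` B = A `|` (B `\` A).
  by rewrite setUDr setDv setD0.
rewrite mU; last by rewrite setDE setICA setICr setI0.
by rewrite lerD2l; apply: finadd_le => // x [].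
Qed.

(** * Regularization of a finitely additive probability *)

Section Content.
Context {R : realType} {X : ptopologicalType} (m : set X -> R).
Hypothesis mm : finadd_probability m.
Local Open Scope ereal_scope.

Lemma inner_content_ub (K U : set X) :
  closed K -> K `<=` U -> (m K)%:E <= inner_content m U.
Proof. by move=> cK KU; apply: ereal_sup_ubound; exists K. Qed.

Lemma inner_content_le (U V : set X) :
  U `<=` V -> inner_content m U <= inner_content m V.
Proof.
move=> UV; apply: ge_ereal_sup => _ [K [cK KU] <-].
by apply: inner_content_ub => //; exact: subset_trans UV.
Qed.

Lemma inner_content_ge0 (U : set X) : 0 <= inner_content m U.
Proof.
rewrite -[leLHS](_ : (m set0)%:E = _); last by rewrite finadd_set0.
by apply: inner_content_ub => //; exact: closed0.
Qed.

Lemma inner_content_le1 (U : set X) : inner_content m U <= 1.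
Proof.
have [m0 mU m1] := mm.
apply: ge_ereal_sup => _ [K [cK KU] <-].
by rewrite lee_fin -m1; exact: finadd_le.
Qed.

Lemma inner_content0 : inner_content m set0 = 0.
Proof.
apply/eqP; rewrite eq_le inner_content_ge0 andbT.
apply: ge_ereal_sup => x [K [cK]]; rewrite subset0 => -> <-.
by rewrite finadd_set0.
Qed.

Lemma inner_contentT : inner_content m setT = 1.
Proof.
apply/eqP; rewrite eq_le inner_content_le1/=.
have [_ _ m1] := mm; have <- : (m setT)%:E = 1 by rewrite m1.
by apply: inner_content_ub => //; exact: closedT.
Qed.

Lemma inner_content_fin_num (U : set X) : inner_content m U \is a fin_num.
Proof.
by rewrite ge0_fin_numE ?inner_content_ge0// (le_lt_trans (inner_content_le1 U)) ?ltry.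
Qed.

Lemma inner_content_adherent (U : set X) (e : R) : (0 < e)%R ->
  exists K, [/\ closed K, K `<=` U & inner_content m U <= (m K)%:E + e%:E].
Proof.
move=> e0.
have [_ [K [cK KU] <-]] := ub_ereal_sup_adherent e0 (inner_content_fin_num U).
by move=> /ltW; rewrite leeBlDr// => h; exists K.
Qed.

Lemma outer_content_le (A B : set X) :
  A `<=` B -> outer_content m A <= outer_content m B.
Proof.
move=> AB; apply: le_ereal_inf_tmp => _ [U [oU BU] <-].
by apply: ereal_inf_lbound; exists U => //; split => //; exact: subset_trans BU.
Qed.

Lemma outer_content_ge0 (A : set X) : 0 <= outer_content m A.
Proof.
by apply: le_ereal_inf_tmp => _ [U [oU AU] <-]; exact: inner_content_ge0.
Qed.

Lemma outer_content_lb (A U : set X) :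
  open U -> A `<=` U -> outer_content m A <= inner_content m U.
Proof. by move=> oU AU; apply: ereal_inf_lbound; exists U. Qed.

Lemma outer_content_open (U : set X) :
  open U -> outer_content m U = inner_content m U.
Proof.
move=> oU; apply/eqP; rewrite eq_le outer_content_lb//=.
by apply: le_ereal_inf_tmp => _ [V [oV UV] <-]; exact: inner_content_le.
Qed.

Lemma outer_content_fin_num (A : set X) : outer_content m A \is a fin_num.
Proof.
rewrite ge0_fin_numE ?outer_content_ge0//.
rewrite (le_lt_trans (outer_content_lb A setT openT (@subsetT _ _)))//.
by rewrite inner_contentT ltry.
Qed.

Lemma outer_content_adherent (A : set X) (e : R) : (0 < e)%R ->
  exists U, [/\ open U, A `<=` U & inner_content m U <= outer_content m A + e%:E].
Proof.
move=> e0.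
have [_ [U [oU AU] <-] /ltW h] := lb_ereal_inf_adherent e0 (outer_content_fin_num A).
by exists U.
Qed.

Hypothesis nX : forall A B : set X, closed A -> closed B -> A `&` B = set0 ->
  exists U V, [/\ open U, open V, A `<=` U, B `<=` V & U `&` V = set0].
Hypothesis cX : compact [set: X].

(** For closed [K] in the union, [K \ U] and [K \ V] are disjoint and closed. Normality gives
    disjoint open [U'] and [V'] around them, so [K \ U'] and [K \ V'] are closed, cover [K], and lie
    in [U] and [V] respectively. *)
Lemma inner_contentU (U V : set X) : open U -> open V ->
  inner_content m (U `|` V) <= inner_content m U + inner_content m V.
Proof.
move=> oU oV; apply: ge_ereal_sup => _ [K [cK KUV] <-].
have [|||U' [V' [oU' oV' KU' KV' UV']]] := nX (K `\` U) (K `\` V).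
- by rewrite setDE; apply: closedI => //; exact: open_closedC.
- by rewrite setDE; apply: closedI => //; exact: open_closedC.
- by rewrite -subset0 => x [[Kx nUx] [_ nVx]]; case: (KUV x Kx).
have -> : K = (K `\` U') `|` (K `\` V').
  by rewrite -setDIr UV' setD0.
apply: (@le_trans _ _ (m (K `\` U') + m (K `\` V'))%:E).
  by rewrite lee_fin; exact: finadd_subadditive.
rewrite EFinD; apply: leeD; apply: inner_content_ub.
- by rewrite setDE; apply: closedI => //; exact: open_closedC.
- by move=> x [Kx nU'x]; apply: contrapT => nUx; apply: nU'x; exact: KU'.
- by rewrite setDE; apply: closedI => //; exact: open_closedC.
- by move=> x [Kx nV'x]; apply: contrapT => nVx; apply: nV'x; exact: KV'.
Qed.

Lemma inner_content_bigsetU (U : nat -> set X) n : (forall i, open (U i)) ->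
  inner_content m (\big[setU/set0]_(i < n) U i) <= \sum_(i < n) inner_content m (U i).
Proof.
move=> oU; elim: n => [|n ih]; first by rewrite !big_ord0 inner_content0.
rewrite !big_ord_recr/=; apply: le_trans (inner_contentU _ _ _ _) _ => //.
  by rewrite -bigcup_mkord; apply: bigcup_open.
by rewrite leeD2r.
Qed.

(** A closed [K] in the union is compact, so finitely many of the [U i] cover it and finite
    subadditivity suffices. *)
Lemma inner_content_bigcup (U : nat -> set X) : (forall i, open (U i)) ->
  inner_content m (\bigcup_i U i) <= \sum_(i <oo) inner_content m (U i).
Proof.
move=> oU; apply: ge_ereal_sup => _ [K [cK KU] <-].
have : compact K by exact: subclosed_compact cX _.
rewrite compact_cover => /(_ nat setT U (fun i _ => oU i)) [|D _ KD].
  by move=> x /KU [i _ Uix]; exists i.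
pose n := (\max_(i <- D) i).+1.
apply: (@le_trans _ _ (inner_content m (\big[setU/set0]_(i < n) U i))).
  apply: inner_content_ub => // x /KD [i iD Uix].
  rewrite -bigcup_mkord; exists i => //=.
  by rewrite /n ltnS (leq_bigmax_seq (F := id)).
apply: le_trans (inner_content_bigsetU _ _ oU) _.
rewrite -(big_mkord xpredT (fun i => inner_content m (U i))).
by apply: nneseries_lim_ge => i _ _; exact: inner_content_ge0.
Qed.

Lemma outer_content_sigma_subadditive : sigma_subadditive (outer_content m).
Proof.
move=> A; apply/lee_addgt0Pr => e e0.
have /choice[U hU] : forall n, exists U, [/\ open U, A n `<=` U &
    inner_content m U <= outer_content m (A n) + (e / (2 ^ n.+1)%:R)%:E].
  by move=> n; apply: outer_content_adherent; rewrite divr_gt0// ltr0n expn_gt0.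
apply: (@le_trans _ _ (inner_content m (\bigcup_i U i))).
  apply: outer_content_lb; first by apply: bigcup_open => i _; have [] := hU i.
  by apply: subset_bigcup => i _; have [] := hU i.
apply: le_trans (inner_content_bigcup _ _) _; first by move=> i; have [] := hU i.
apply: le_trans (epsilon_trick xpredT _ (ltW e0)); last first.
  by move=> n; exact: outer_content_ge0.
apply: lee_nneseries => [i _ _|n _]; first exact: inner_content_ge0.
by have [] := hU n.
Qed.

(** Inside an open [V] containing [A], a closed [K] nearly exhausts [V] within [U], and then a
    closed [L] nearly exhausts [V \ K]. That set is used instead of [V \ U] because it is open and
    still contains the rest of [A]. As [K] and [L] are disjoint, additivity of [m] applies. *)
Lemma outer_content_caratheodory_open (U : set X) : open U ->
  forall A, outer_content m (A `&` U) + outer_content m (A `&` ~` U) <=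
            outer_content m A.
Proof.
move=> oU A; apply: le_ereal_inf_tmp => _ [V [oV AV] <-].
apply/lee_addgt0Pr => e e0; have e20 : (0 < e / 2)%R by rewrite divr_gt0.
have [K [cK KVU hK]] := inner_content_adherent (V `&` U) _ e20.
have [L [cL LVK hL]] := inner_content_adherent (V `\` K) _ e20.
have oVU : open (V `&` U) by exact: openI.
have oVK : open (V `\` K) by rewrite setDE; apply: openI => //; exact: closed_openC.
apply: (@le_trans _ _ (((m K)%:E + (e / 2)%:E) + ((m L)%:E + (e / 2)%:E))).
  apply: leeD.
    by apply: le_trans hK; apply: outer_content_lb => //; exact: setSI.
  apply: le_trans hL; apply: outer_content_lb => // x [Ax nUx].
  by split; [exact: AV|move=> /KVU[]].
rewrite addeACA -!EFinD -splitr EFinD leeD2r//.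
have [_ mU _] := mm; rewrite -mU; last first.
  by rewrite -subset0 => x [Kx /LVK[]].
apply: inner_content_ub; first exact: closedU.
by move=> x [/KVU[]//|/LVK[]].
Qed.

End Content.

Lemma outer_content_measure (R : realType) (X : ptopologicalType) (m : set X -> R) :
  finadd_probability m ->
  (forall A B : set X, closed A -> closed B -> A `&` B = set0 ->
    exists U V, [/\ open U, open V, A `<=` U, B `<=` V & U `&` V = set0]) ->
  compact [set: X] ->
  exists mu : probability (borel X) R,
    forall A : set (borel X), mu A = outer_content m A.
Proof.
move=> mm nX cX.
have o0 : outer_content m set0 = 0%E.
  by rewrite outer_content_open ?inner_content0//; exact: open0.
pose om : {outer_measure set X -> \bar R} := HB.pack_for
  {outer_measure set X -> \bar R} (outer_content m)
  (isOuterMeasure.Build R X (outer_content m) o0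
    (outer_content_ge0 m mm) (outer_content_le m)
    (outer_content_sigma_subadditive m mm nX cX)).
(* Open sets are Caratheodory measurable, hence so is the sigma-algebra that they generate. *)
have sub (A : set (borel X)) : measurable A ->
    (measurable : set (set (caratheodory_type om))) A.
  apply: smallest_sub; first exact: sigma_algebra_measurable.
  by move=> U oU; apply: le_caratheodory_measurable;
    exact: outer_content_caratheodory_open.
pose mu : set (borel X) -> \bar R := outer_content m.
have sadd : semi_sigma_additive mu.
  move=> F mF tF mUF.
  apply: (@caratheodory_measure_sigma_additive R X om) => // [i|].
    exact: sub.
  exact: sub.
pose mu1 : {measure set (borel X) -> \bar R} := HB.pack_for
  {measure set (borel X) -> \bar R} mu
  (isMeasure.Build _ (borel X) R mu o0 (outer_content_ge0 m mm) sadd).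
have muT : mu setT = 1%E.
  by rewrite /mu outer_content_open ?inner_contentT//; exact: openT.
pose mu2 : probability (borel X) R := HB.pack_for (probability (borel X) R)
  (Measure.sort mu1) (Measure_isProbability.Build _ (borel X) R mu1 muT).
by exists mu2.
Qed.

(** Homeomorphisms permute closed sets and open sets, so both regularizations inherit the invariance
    of [m]. Each inequality is proved for one map and then applied to its inverse. *)
Lemma outer_content_preimage (R : realType) (X : ptopologicalType) (m : set X -> R)
    (f f' : X -> X) : continuous f -> continuous f' -> cancel f f' -> cancel f' f ->
  (forall A, m (f @^-1` A) = m A) ->
  forall A, outer_content m (f @^-1` A) = outer_content m A.
Proof.
move=> cf cf' fK f'K mf A.
have mf' B : m (f' @^-1` B) = m B.
  by rewrite -mf; congr m; apply/seteqP; split => x /=; rewrite fK.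
have inner_le (g : X -> X) : continuous g -> (forall B, m (g @^-1` B) = m B) ->
    forall U, (inner_content m U <= inner_content m (g @^-1` U))%E.
  move=> cg mg U; apply: ge_ereal_sup => _ [K [cK KU] <-].
  rewrite -mg; apply: inner_content_ub; last by move=> x; exact: KU.
  by apply: preimage_closed => // x _; exact: cg.
have outer_le (g g' : X -> X) : continuous g -> continuous g' -> cancel g' g ->
    (forall B, m (g' @^-1` B) = m B) ->
    forall B, (outer_content m (g @^-1` B) <= outer_content m B)%E.
  move=> cg cg' g'K mg' B; apply: le_ereal_inf_tmp => _ [U [oU BU] <-].
  apply: (@le_trans _ _ (inner_content m (g @^-1` U))).
    apply: outer_content_lb; last by move=> x; exact: BU.
    by apply: open_comp => // x _; exact: cg.
  apply: le_trans (inner_le g' cg' mg' _) _.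
  by rewrite -comp_preimage (_ : g \o g' = id)//; apply/funext.
apply/eqP; rewrite eq_le; apply/andP; split; first exact: (outer_le f f').
have := outer_le f' f cf' cf fK mf (f @^-1` A).
by rewrite -comp_preimage (_ : f \o f' = id)//; apply/funext.
Qed.

(** * Averages along a Folner sequence *)

(** Compactness of the segment gives a cluster point, and a cluster point of an ultrafilter is a
    limit: the ultrafilter contains the preimage of each neighbourhood or its complement, and the
    latter is excluded. *)
Lemma ultrafilter_cvg_segment (R : realType) (T : Type) (U : set_system T)
    (a b : R) (f : T -> R) : UltraFilter U -> (forall t, a <= f t <= b) ->
  cvg (f @ U).
Proof.
move=> UU fab.
have fU : (f @ U) `[a, b]%classic.
  suff: U (f @^-1` `[a, b]) by [].
  by apply: filterE => t; rewrite /= in_itv /= fab.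
have [p [_ clp]] := @segment_compact R a b (f @ U) _ fU.
apply: (cvgP p) => B pB.
have [//|nB] := in_ultra_setVsetC (f @^-1` B) UU.
by have [t []] := clp _ _ (nB : (f @ U) (~` B)) pB.
Qed.

Definition visit_freq {R : realType} {G : choiceType} {X : Type}
    (act : G -> X -> X) (x0 : X) (S : {fset G}) (A : set X) : R :=
  (count (fun g => `[< A (act g x0) >]) S)%:R / (#|` S|)%:R.

Lemma count_fset_le (G : choiceType) (P : pred G) (S T : {fset G}) :
  (count P S <= count P T + #|` fsetD S T|)%N.
Proof.
rewrite -!size_filter -size_cat; apply: uniq_leq_size.
  by rewrite filter_uniq// fset_uniq.
move=> g; rewrite mem_filter mem_cat mem_filter => /andP[-> gS] /=.
by case gT: (g \in T) => //=; rewrite in_fsetD gT.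
Qed.

(** Visits to the preimage of [A] at times in [S] are visits to [A] at times in [h S], so the two
    counts differ by at most the size of the symmetric difference. *)
Lemma visit_freq_invariance (R : realType) (G : choiceType) (mul : G -> G -> G)
    (X : Type) (act : G -> X -> X) (x0 : X) (S : {fset G}) (h : G) (A : set X) :
  injective (mul h) -> (forall g x, act (mul h g) x = act h (act g x)) ->
  `|visit_freq act x0 S (act h @^-1` A) - visit_freq act x0 S A : R| <=
    #|` fsymdiff (lmulF mul h S) S|%:R / #|` S|%:R.
Proof.
move=> hI actM; rewrite /visit_freq -mulrBl normrM.
rewrite [X in _ * X <= _]ger0_norm ?invr_ge0// ler_wpM2r ?invr_ge0//.
set P := fun g => `[< A (act g x0) >].
have -> : count (fun g => `[< (act h @^-1` A) (act g x0) >]) S =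
    count P (lmulF mul h S).
  have /permP -> : perm_eq (lmulF mul h S) [seq mul h g | g <- S].
    apply: uniq_perm; rewrite ?fset_uniq ?map_inj_uniq ?fset_uniq//.
    move=> g; apply/imfsetP/mapP => -[k kS ->]; by exists k.
  by rewrite count_map; apply: eq_count => g /=; rewrite /P actM.
set T := lmulF mul h S; rewrite /fsymdiff.
have ST := count_fset_le _ P S T; have TS := count_fset_le _ P T S.
have DU : (#|` fsetD T S| <= #|` fsetU (fsetD T S) (fsetD S T)|)%N.
  by apply: fsubset_leq_card; exact: fsubsetUl.
have UD : (#|` fsetD S T| <= #|` fsetU (fsetD T S) (fsetD S T)|)%N.
  by apply: fsubset_leq_card; exact: fsubsetUr.
rewrite ler_norml; apply/andP; split.
  rewrite lerNl opprB lerBlDl -natrD ler_nat.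
  by apply: leq_trans ST _; rewrite leq_add2l.
rewrite lerBlDl -natrD ler_nat.
by apply: leq_trans TS _; rewrite leq_add2l.
Qed.

(** An ultrafilter finer than [\oo] makes the frequencies of all subsets converge at once, and these
    limits are additive. The last clause lets the mass be located from the orbit of [x0] alone. *)
Lemma folner_invariant_finadd (R : realType) (G : choiceType) (mul : G -> G -> G)
    (X : Type) (act : G -> X -> X) (F : nat -> {fset G}) (x0 : X) :
  Folner (R := R) mul F -> (forall h, injective (mul h)) ->
  (forall h g x, act (mul h g) x = act h (act g x)) ->
  exists m : set X -> R, [/\ finadd_probability m,
    (forall h A, m (act h @^-1` A) = m A) &
    (forall A, (forall g, A (act g x0)) -> m A = 1)].
Proof.
move=> [F0 Finv] mulI actM.
have [U [UU ooU]] := ultraFilterLemma eventually_filter.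
pose fr A n : R := visit_freq act x0 (F n) A.
have FC n : 0 < #|` F n|%:R :> R by rewrite ltr0n cardfs_gt0.
have fr01 A n : 0 <= fr A n <= 1.
  rewrite divr_ge0//= ler_pdivrMr// mul1r ler_nat.
  exact: count_size.
have frc A : cvg (fr A @ U) by exact: ultrafilter_cvg_segment _ _ _ 0 1 _ _ (fr01 A).
pose m A := lim (fr A @ U).
have mE A l : fr A @ U --> l -> m A = l by move=> h; exact: cvg_lim.
have m1 A : (forall g, A (act g x0)) -> m A = 1.
  move=> Ax; apply: mE; rewrite (_ : fr A = cst 1); first exact: cvg_cst.
  apply/funext => n; rewrite /fr /visit_freq (eq_count (a2 := predT)).
    by rewrite count_predT divff// gt_eqF.
  by move=> g /=; apply/asboolP.
exists m; split => //.
- split.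
  + by move=> A; apply: limr_ge => //; near=> n; have /andP[] := fr01 A n.
  + move=> A B AB; apply: mE.
    have -> : fr (A `|` B) = fr A + fr B.
      apply/funext => n; transitivity (fr A n + fr B n); last by [].
      rewrite /fr /visit_freq -mulrDl -natrD.
      rewrite -count_predUI [X in (_ + X)%N](_ : _ = 0%N) ?addn0.
        congr (_%:R / _); apply: eq_count => g /=.
        by rewrite -asbool_or.
      apply/eqP; rewrite -leqn0 leqNgt -has_count -all_predC.
      apply/allP => g _ /=; apply/negP => /andP[/asboolP Ag /asboolP Bg].
      by have : (A `&` B) (act g x0) by []; rewrite AB.
    by apply: cvgD; exact: frc.
  + exact: m1.
- move=> h A; apply: mE.
  (* The added difference tends to 0, being dominated by the Folner ratio for [h]. *)
  have -> : fr (act h @^-1` A) = fr A + (fr (act h @^-1` A) - fr A).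
    by rewrite addrC subrK.
  rewrite -[m A]addr0; apply: cvgD; first exact: frc.
  apply/norm_cvg0P; apply: (squeeze_cvgr _ (cvg_cst 0)); last first.
    by apply: cvg_trans (Finv h); exact: cvg_app.
  near=> n; rewrite normr_ge0/=; exact: visit_freq_invariance.
Unshelve. all: by end_near. Qed.

(** * Growth of separated sets *)

Lemma limf_esup_lt (R : realType) (X : choiceType) (T : filteredType X)
    (f : T -> \bar R) (F : set_system T) (c : \bar R) : Filter F ->
  (limf_esup f F < c)%E -> \forall x \near F, (f x < c)%E.
Proof.
move=> FF /ereal_inf_lt [_ [V FV <-] Vc]; apply: filterS FV => x Vx.
by apply: le_lt_trans Vc; apply: ereal_sup_ubound; exists x.
Qed.

Lemma limf_esup_le (R : realType) (X : choiceType) (T : filteredType X)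
    (f : T -> \bar R) (F : set_system T) (c : \bar R) :
  (\forall x \near F, (f x <= c)%E) -> (limf_esup f F <= c)%E.
Proof.
move=> FV; apply: le_trans (ereal_inf_lbound _) _; first by exists [set x | (f x <= c)%E].
by apply: ge_ereal_sup => _ [x xc <-].
Qed.

Definition separated {R : realType} {X : choiceType} (dd : X -> X -> R) (e : R)
    (E : {fset X}) : Prop :=
  {in E &, forall x y, x != y -> e < dd x y}.

(* For nonempty [Z], the [c] with this property have infimum [mdimM Z]; it does not
   involve extended reals, nor the logarithm of a supremum. *)
Definition sep_growth_le {R : realType} {G : choiceType} {X : pseudoPMetricType R}
    (act : G -> X -> X) (d : X -> X -> R) (F : nat -> {fset G}) (Z : set X) (c : R) :=
  exists2 r : R, 0 < r & forall e, 0 < e < r -> \forall n \near \oo,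
    forall E : {fset X}, [set` E] `<=` Z -> separated (dF act d (F n)) e E ->
    (#|` E|)%:R <= expR (c * ln e^-1 * (#|` F n|)%:R).

Lemma ln_inv_ge (R : realType) (e t : R) : 0 < e -> e < expR (- t) -> t <= ln e^-1.
Proof.
move=> e0 et; rewrite lnV ?posrE// lerNr; apply/ltW.
by rewrite -ltr_expR lnK ?posrE.
Qed.

Lemma near_right0P (R : realType) (P : R -> Prop) :
  (\forall e \near (0:R)^'+, P e) <-> (exists2 r : R, 0 < r & forall e, 0 < e < r -> P e).
Proof.
split.
  move=> [r /= r0 h]; exists r => // e /andP[e0 er]; apply: h => //=.
  by rewrite sub0r normrN gtr0_norm.
move=> [r r0 h]; exists r => //= e /=; rewrite sub0r normrN => er e0.
by apply: h; rewrite e0 (le_lt_trans (ler_norm e)).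
Qed.

Section Growth.
Context {R : realType} {G : choiceType} {X : pseudoPMetricType R}.
Variables (act : G -> X -> X) (d : X -> X -> R) (F : nat -> {fset G}).
Hypothesis F0 : forall n, F n != fset0.

Let FC n : 0 < (#|` F n|)%:R :> R.
Proof. by rewrite ltr0n cardfs_gt0. Qed.

Lemma sep_num_ub (Z : set X) (dd : X -> X -> R) (e : R) (E : {fset X}) :
  [set` E] `<=` Z -> separated dd e E -> ((#|` E|)%:R%:E <= sep_num Z dd e)%E.
Proof. by move=> EZ Es; apply: ereal_sup_ubound; exists E. Qed.

Lemma sep_num_ge1 (Z : set X) (dd : X -> X -> R) (e : R) :
  Z !=set0 -> (1 <= sep_num Z dd e)%E.
Proof.
move=> [z Zz]; have := @sep_num_ub Z dd e [fset z]%fset; rewrite cardfs1; apply.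
  by move=> x /=; rewrite inE => /eqP ->.
by move=> x y; rewrite !inE => /eqP -> /eqP ->; rewrite eqxx.
Qed.

(** A one-point [E] keeps [sep_num] at least 1 for nonempty [Z], away from the arguments where [ln]
    takes its default value. *)
Lemma eln_sep_num_le (Z : set X) (dd : X -> X -> R) (e a : R) : Z !=set0 ->
  (eln (sep_num Z dd e) <= a%:E)%E <->
  (forall E : {fset X}, [set` E] `<=` Z -> separated dd e E ->
    (#|` E|)%:R <= expR a).
Proof.
move=> Z0; have := @sep_num_ge1 Z dd e Z0; split.
  move: H => + + E EZ Es; have := @sep_num_ub Z dd e E EZ Es.
  case: (sep_num Z dd e) => [r| |]//=; rewrite !lee_fin => Er r1 ra.
  by apply: le_trans Er _; rewrite -(@lnK _ r) ?posrE ?ler_expR// (lt_le_trans _ r1).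
move=> h; have : (sep_num Z dd e <= (expR a)%:E)%E.
  by apply: ge_ereal_sup => _ [E [EZ Es] <-]; rewrite lee_fin; exact: h.
move: H; case: (sep_num Z dd e) => [r| |]//=; rewrite !lee_fin => r1 ra.
by rewrite -ler_expR lnK// posrE (lt_le_trans _ r1).
Qed.

Lemma sep_growth_of_mdimM (Z : set X) (c : R) : Z !=set0 ->
  (mdimM act d F Z < c%:E)%E -> sep_growth_le act d F Z c.
Proof.
move=> Z0 /limf_esup_lt /near_right0P [r r0 h].
(* Below 1 the number [ln e^-1] is positive, so the division by it can be cleared. *)
exists (Num.min r 1); first by rewrite lt_min r0 ltr01.
move=> e /andP[e0]; rewrite lt_min => /andP[er e1].
have L0 : 0 < ln e^-1 by rewrite ln_gt0// invf_gt1.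
have := h e; rewrite e0 er => /(_ isT); rewrite lte_pdivrMr// -EFinM.
move=> /limf_esup_lt; apply: filterS => n.
by rewrite lte_pdivrMr// -EFinM => /ltW /(eln_sep_num_le _ _ _ _ Z0).
Qed.

Lemma mdimM_of_sep_growth (Z : set X) (c : R) : Z !=set0 ->
  sep_growth_le act d F Z c -> (mdimM act d F Z <= c%:E)%E.
Proof.
move=> Z0 [r r0 h]; apply: limf_esup_le; apply/near_right0P.
exists (Num.min r 1); first by rewrite lt_min r0 ltr01.
move=> e /andP[e0]; rewrite lt_min => /andP[er e1].
have L0 : 0 < ln e^-1 by rewrite ln_gt0// invf_gt1.
rewrite lee_pdivrMr// -EFinM; apply: limf_esup_le.
have := h e; rewrite e0 er => /(_ isT); apply: filterS => n hn.
by rewrite lee_pdivrMr// -EFinM; apply/(eln_sep_num_le _ _ _ _ Z0).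
Qed.

Lemma sep_growthU (Z1 Z2 : set X) (c c' : R) : c < c' ->
  sep_growth_le act d F Z1 c -> sep_growth_le act d F Z2 c ->
  sep_growth_le act d F (Z1 `|` Z2) c'.
Proof.
move=> cc' [r1 r10 h1] [r2 r20 h2].
(* For [e < expR (- t)] the slack [(c' - c) * ln e^-1] is at least [ln 2], which pays for adding the
   two counts. *)
pose t := ln 2 / (c' - c).
exists (Num.min (Num.min r1 r2) (expR (- t))); first by rewrite !lt_min r10 r20 expR_gt0.
move=> e /andP[e0]; rewrite !lt_min => /andP[/andP[er1 er2] /(ln_inv_ge _ _ _ e0) et].
have := h1 e; rewrite e0 er1 => /(_ isT); apply: filter_app.
have := h2 e; rewrite e0 er2 => /(_ isT); apply: filterS => n H2 H1 E EZ Es.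
pose E1 := [fset x in E | x \in Z1]%fset; pose E2 := [fset x in E | x \notin Z1]%fset.
have E1l : (#|` E1|)%:R <= expR (c * ln e^-1 * (#|` F n|)%:R).
  apply: H1; first by move=> x /=; rewrite !inE => /andP[_ /set_mem].
  by move=> x y; rewrite !inE => /andP[xE _] /andP[yE _]; exact: Es.
have E2l : (#|` E2|)%:R <= expR (c * ln e^-1 * (#|` F n|)%:R).
  apply: H2.
    move=> x /=; rewrite !inE => /andP[xE /negP xZ].
    by case: (EZ x xE) => // Zx; case: xZ; apply/mem_set.
  by move=> x y; rewrite !inE => /andP[xE _] /andP[yE _]; exact: Es.
have EE : (#|` E| <= #|` E1| + #|` E2|)%N.
  apply: leq_trans (leq_subr #|` fsetI E1 E2| _).
  rewrite -cardfsU; apply: fsubset_leq_card; apply/fsubsetP => x xE.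
  by rewrite !inE xE /= orbN.
apply: (@le_trans _ _ (expR (ln 2 + c * ln e^-1 * (#|` F n|)%:R))).
  rewrite expRD lnK ?posrE// mulr_natl mulr2n.
  by apply: le_trans (lerD E1l E2l); rewrite -natrD ler_nat.
rewrite ler_expR -lerBrDr -mulrBl -mulrBl.
have F1 : 1 <= (#|` F n|)%:R :> R by rewrite ler1n cardfs_gt0.
have c0 : 0 < c' - c by rewrite subr_gt0.
apply: (@le_trans _ _ ((c' - c) * ln e^-1)).
  by rewrite mulrC -ler_pdivrMr.
rewrite ler_peMr// mulr_ge0 ?(ltW c0)// (le_trans _ et)//.
by rewrite divr_ge0 ?(ltW c0)// ln_ge0// ler1n.
Qed.

End Growth.

(** * Separated sets under translation *)

(** The colour of a point is the centre of a ball of radius [e / 2] containing it, chosen from a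
    finite subcover. Colours turn closeness at a single time into finite data that can be
    counted. *)
Lemma finite_coloring (R : realType) (X : pseudoPMetricType R) (d : X -> X -> R)
    (e : R) : compact [set: X] -> metric_for d -> 0 < e ->
  exists (C : finType) (kappa : X -> C), forall x y, kappa x = kappa y -> d x y <= e.
Proof.
move=> cX [_ dC dT dball] e0; have e20 : 0 < e / 2 by rewrite divr_gt0.
move: cX; rewrite compact_cover => /(_ X setT (fun x => (ball x (e / 2))^°)) [].
- by move=> x _; exact: open_interior.
- by move=> x _; exists x => //; rewrite /interior; exact: nbhsx_ballx.
move=> D _ XD.
have /choice[kappa kappaP] : forall x, exists i : D, d (val i) x < e / 2.
  move=> x; have [i iD /interior_subset] := XD x I.
  by rewrite dball// => ix; exists [` iD]%fset.
exists D, kappa => x y kxy; apply: le_trans (dT _ (val (kappa x)) _) _.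
rewrite (splitr e) dC; apply: lerD; apply/ltW; first exact: kappaP.
by rewrite kxy; exact: kappaP.
Qed.

(** Greedy selection along the list: a point enters [M] only when it is far from all points chosen
    so far. *)
Lemma maximal_separated (R : realType) (X : choiceType) (dd : X -> X -> R) (e : R)
    (E : {fset X}) : (forall x y, dd x y = dd y x) -> (forall x, dd x x <= e) ->
  exists M : {fset X}, [/\ {subset M <= E}, separated dd e M &
    forall x, x \in E -> exists2 y, y \in M & dd x y <= e].
Proof.
move=> ddC dd0.
suff H (s : seq X) : exists M : {fset X}, [/\ {subset M <= s}, separated dd e M &
    forall x, x \in s -> exists2 y, y \in M & dd x y <= e] by exact: H.
elim: s => [|x s [M [Ms Msep Mnear]]].
  by exists fset0; split => // x; rewrite ?inE.
have [[y yM xy]|far] := pselect (exists2 y, y \in M & dd x y <= e).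
  exists M; split => //; first by move=> z /Ms; rewrite inE orbC => ->.
  move=> z; rewrite inE => /orP[/eqP ->|/Mnear//].
  by exists y.
have xM y : y \in M -> e < dd x y.
  by move=> yM; rewrite ltNge; apply/negP => xy; apply: far; exists y.
exists (x |` M)%fset; split.
- by move=> z; rewrite !inE => /orP[->//|/Ms ->]; rewrite orbT.
- move=> y z; rewrite !inE => /orP[/eqP ->|yM] /orP[/eqP ->|zM]; rewrite ?eqxx//.
  + by move=> _; exact: xM.
  + by move=> _; rewrite ddC; exact: xM.
  + exact: Msep.
- move=> z; rewrite inE => /orP[/eqP ->|/Mnear[y yM zy]].
    by exists x; rewrite ?inE ?eqxx.
  by exists y => //; rewrite !inE yM orbT.
Qed.

Section Preimage.
Context {R : realType} {G : choiceType} {X : pseudoPMetricType R}.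
Variables (mul : G -> G -> G) (act : G -> X -> X) (d : X -> X -> R).
Hypothesis md : metric_for d.
Hypothesis actM : forall g h x, act (mul g h) x = act g (act h x).

Lemma metric_for_ge0 (x y : X) : 0 <= d x y.
Proof.
have [d0 dC dT _] := md; have := dT x y x.
by rewrite (d0 x x).2// (dC y x) -mulr2n pmulrn_lge0.
Qed.

Lemma dF_ub (A : {fset G}) (g : G) (x y : X) :
  g \in A -> d (act g x) (act g y) <= dF act d A x y.
Proof. by move=> gA; apply: le_bigmax_seq. Qed.

Lemma dF_le (A : {fset G}) (e : R) (x y : X) : 0 <= e ->
  (forall g, g \in A -> d (act g x) (act g y) <= e) -> dF act d A x y <= e.
Proof. by move=> e0 h; rewrite /dF big_seq; apply: bigmax_le => // g /h. Qed.

Lemma dFC (A : {fset G}) (x y : X) : dF act d A x y = dF act d A y x.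
Proof. by have [_ dC _ _] := md; apply: eq_bigr => g _; exact: dC. Qed.

(* Each [x] in [E] is determined by a point of a maximal [e / 2]-separated
   subset of [act g @` E] close to [act g x] and by the colours of [act a x]
   for [a] in [A] but not in [A g]. *)
Lemma separated_preimage_card (A : {fset G}) (g : G) (C : finType) (kappa : X -> C)
    (e N : R) (E : {fset X}) (K : set X) : 0 <= e -> injective (act g) ->
  (forall x y, kappa x = kappa y -> d x y <= e) ->
  (forall M : {fset X}, [set` M] `<=` K -> separated (dF act d A) (e / 2) M ->
     (#|` M|)%:R <= N) ->
  [set` E] `<=` act g @^-1` K -> separated (dF act d A) e E ->
  (#|` E|)%:R <= N * (#|C| ^ #|` fsetD A (rmulF mul A g)|)%:R.
Proof.
move=> e0 gI kappaP hN EK Es; have [d0 dC dT _] := md.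
have e20 : 0 <= e / 2 by rewrite divr_ge0.
have dF0 x : dF act d A x x <= e / 2.
  by apply: dF_le => // h _; rewrite (d0 _ _).2.
have [M [Msub Msep Mnear]] := maximal_separated _ _ _ _
  [fset act g x | x in E]%fset (dFC A) dF0.
have MN : (#|` M|)%:R <= N.
  apply: hN => // x /= /Msub /imfsetP[y /= yE ->]; exact: (EK y yE).
set B := fsetD A (rmulF mul A g).
have /choice[p pP] : forall x : E, exists y : M,
    dF act d A (act g (val x)) (val y) <= e / 2.
  move=> x; have [|y yM xy] := Mnear (act g (val x)).
    by apply/imfsetP; exists (val x) => //=; exact: valP.
  by exists [` yM]%fset.
pose f (x : E) : M * {ffun B -> C} :=
  (p x, [ffun b : B => kappa (act (val b) (val x))]).
have fI : injective f.
  move=> x y [pxy] /ffunP kxy; apply: val_inj; apply/eqP/negPn/negP => xy.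
  have := Es _ _ (valP x) (valP y) xy; rewrite ltNge => /negP; apply.
  apply: dF_le => // a aA.
  (* If [a = b g] with [b] in [A], then [act a x] and [act a y] are both within [e / 2] of the image
     under [act b] of the common point [p x]. Otherwise the equal colours at time [a] give the
     bound. *)
  have [aB|] := boolP (a \in rmulF mul A g); last first.
    move=> aB; have aB' : a \in B by rewrite inE aB aA.
    by have := kxy [` aB']%fset; rewrite !ffunE; exact: kappaP.
  have /imfsetP[b /= bA ->] := aB; rewrite !actM.
  apply: le_trans (dT _ (act b (val (p x))) _) _; rewrite (splitr e); apply: lerD.
    exact: le_trans (dF_ub _ _ _ _ bA) (pP x).
  rewrite dC pxy; exact: le_trans (dF_ub _ _ _ _ bA) (pP y).
have := leq_card f fI; rewrite card_prod card_ffun -!cardfE => le.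
apply: (@le_trans _ _ ((#|` M| * #|C| ^ #|` B|)%N%:R)); first by rewrite ler_nat.
by rewrite natrM ler_wpM2r.
Qed.

End Preimage.

(** With [e] and hence the number of colours fixed, the right Folner condition makes [F n] minus
    [F n g] so small that the colours contribute at most [expR |F n|] eventually. Replacing [e] by
    [e / 2] costs [c * ln 2] in the rate. Both losses are absorbed by [(c' - c) * ln e^-1] when [e]
    is small. *)
Lemma sep_growth_preimage (R : realType) (G : choiceType) (X : pseudoPMetricType R)
    (mul : G -> G -> G) (act : G -> X -> X) (d : X -> X -> R) (F : nat -> {fset G})
    (g : G) (K : set X) (c c' : R) :
  compact [set: X] -> metric_for d ->
  (forall g h x, act (mul g h) x = act g (act h x)) ->
  two_sided_Folner (R := R) mul F -> injective (act g) -> c < c' ->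
  sep_growth_le act d F K c -> sep_growth_le act d F (act g @^-1` K) c'.
Proof.
move=> cX md actM [[F0 _] Fr] gI cc' [r r0 h].
(* The 1 pays for the colours and [c * ln 2] for halving [e]. *)
pose t := (1 + c * ln 2) / (c' - c).
exists (Num.min r (expR (- t))); first by rewrite lt_min r0 expR_gt0.
move=> e /andP[e0]; rewrite lt_min => /andP[er /(ln_inv_ge _ _ _ e0) et].
have e20 : 0 < e / 2 by rewrite divr_gt0.
have [C [kappa kappaP]] := finite_coloring _ _ _ _ cX md e0.
have C0 : (0 < #|C|)%N by apply/card_gt0P; exists (kappa point).
(* Adding 1 keeps [l] positive when there is a single colour, so that [l^-1] is a valid bound for
   the Folner ratio. *)
pose l : R := ln (#|C|%:R) + 1.
have l0 : 0 < l by rewrite ltr_wpDl// ln_ge0// ler1n.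
have : \forall n \near \oo, (#|` fsymdiff (rmulF mul (F n) g) (F n)|)%:R
    / (#|` F n|)%:R < l^-1 :> R.
  by have := cvgr_lt _ (Fr g) (l^-1); apply; rewrite invr_gt0.
apply: filter_app.
have := h (e / 2); rewrite e20 ltr_pdivrMr//=.
have -> : e < r * 2 by rewrite (lt_le_trans er)// ler_pMr ?ler1n.
move=> /(_ isT); apply: filterS => n hn Fn E EK Es.
have FC : 0 < (#|` F n|)%:R :> R by rewrite ltr0n cardfs_gt0.
have := @separated_preimage_card R G X mul act d md actM (F n) g C kappa e _ E K
  (ltW e0) gI kappaP hn EK Es; move=> /le_trans; apply.
set B := fsetD _ _.
have BF : (#|` B|)%:R * l <= (#|` F n|)%:R.
  rewrite -ler_pdivlMr// mulrC -ler_pdivrMr//; apply: le_trans (ltW Fn).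
  rewrite ler_wpM2r ?invr_ge0// ler_nat.
  by apply: fsubset_leq_card; exact: fsubsetUr.
have CB : ((#|C| ^ #|` B|)%N%:R : R) <= expR (#|` F n|)%:R.
  rewrite natrX -[X in X ^+ _](@lnK R) ?posrE ?ltr0n// -expRM_natl ler_expR.
  by apply: le_trans BF; rewrite -mulr_natl ler_wpM2l// lerDl.
apply: (@le_trans _ _ (expR (c * ln (e / 2)^-1 * (#|` F n|)%:R) * expR (#|` F n|)%:R)).
  by rewrite ler_wpM2l// expR_ge0.
rewrite -expRD ler_expR -[X in _ + X <= _]mul1r -mulrDl ler_wpM2r//.
have -> : ln (e / 2)^-1 = ln e^-1 + ln 2.
  by rewrite invf_div lnM ?posrE ?invr_gt0// addrC.
have c0 : 0 < c' - c by rewrite subr_gt0.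
by rewrite mulrDr -addrA -lerBrDl -mulrBl -ler_pdivrMl// mulrC addrC.
Qed.

(** * Local metric mean dimension *)

Lemma ereal_real_between (R : realType) (x y : \bar R) : (0 <= x)%E -> (x < y)%E ->
  exists2 r : R, (x < r%:E)%E & (r%:E < y)%E.
Proof.
case: x y => [x| |] [y| |]//= _ xy.
- by exists ((x + y) / 2); rewrite lte_fin; rewrite lte_fin in xy; rewrite ?midf_lt.
- by exists (x + 1); rewrite ?ltry// lte_fin ltrDl.
Qed.

Lemma act_inv_cancel (G X : Type) (mul : G -> G -> G) (one : G) (inv : G -> G)
    (act : G -> X -> X) : is_group mul one inv -> is_action mul one act ->
  forall g, cancel (act g) (act (inv g)) /\ cancel (act (inv g)) (act g).
Proof.
move=> [mulA mul1 mulV] [act1 actM] g.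
have gK h : cancel (act h) (act (inv h)) by move=> x; rewrite -actM mulV act1.
(* Only left inverses are given by [is_group]; cancelling [inv g] against its own inverse yields the
   other side. *)
split=> // x; by rewrite -[LHS](gK (inv g)) (gK g) (gK (inv g)).
Qed.

Section LocalMeanDimension.
Context {R : realType} {G : choiceType} {X : pseudoPMetricType R}.
Variables (act : G -> X -> X) (d : X -> X -> R) (F : nat -> {fset G}).
Hypothesis F0 : forall n, F n != fset0.
Hypothesis cX : compact [set: X].

Lemma sep_growth_weaken (Z : set X) (c c' : R) : c <= c' ->
  sep_growth_le act d F Z c -> sep_growth_le act d F Z c'.
Proof.
move=> cc' [r r0 h]; exists (Num.min r 1); first by rewrite lt_min r0 ltr01.
move=> e /andP[e0]; rewrite lt_min => /andP[er e1].
have L0 : 0 < ln e^-1 by rewrite ln_gt0// invf_gt1.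
have := h e; rewrite e0 er => /(_ isT); apply: filterS => n hn E EZ Es.
apply: le_trans (hn E EZ Es) _; rewrite ler_expR ler_wpM2r//.
by rewrite ler_wpM2r// ltW.
Qed.

(** A negative value would give some [e < 1] and some [n] with a negative logarithm of [sep_num],
    which is at least 1. *)
Lemma mdimM_ge0 (Z : set X) : Z !=set0 -> (0 <= mdimM act d F Z)%E.
Proof.
move=> Z0; rewrite leNgt; apply/negP => /limf_esup_lt /near_right0P[r r0 h].
pose e : R := Num.min r 1 / 2.
have m0 : 0 < Num.min r 1 by rewrite lt_min r0 ltr01.
have e0 : 0 < e by rewrite divr_gt0.
have em : e < Num.min r 1 by rewrite /e ltr_pdivrMr// ltr_pMr// ltr1n.
move: em; rewrite lt_min => /andP[er e1].
have L0 : 0 < ln e^-1 by rewrite ln_gt0// invf_gt1.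
have := h e; rewrite e0 er => /(_ isT); rewrite lte_pdivrMr// mul0e.
move=> /limf_esup_lt /filter_ex[n].
have FC : 0 < (#|` F n|)%:R :> R by rewrite ltr0n cardfs_gt0.
rewrite lte_pdivrMr// mul0e ltNge => /negP; apply.
have := @sep_num_ge1 R X Z (dF act d (F n)) e Z0.
by case: (sep_num _ _ _) => [s| |]//=; rewrite !lee_fin => /ln_ge0.
Qed.

Lemma nbhs_neq0 (x : X) (K : set X) : nbhs x K -> K !=set0.
Proof. by move=> /nbhs_singleton Kx; exists x. Qed.

Lemma mdim_loc_ge0 (x : X) : (0 <= mdim_loc act d F x)%E.
Proof.
by apply: le_ereal_inf_tmp => _ [K [_ /nbhs_neq0 K0] <-]; exact: mdimM_ge0.
Qed.

Lemma mdim_loc_le_nbhs (x : X) (K : set X) : closed K -> nbhs x K ->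
  (mdim_loc act d F x <= mdimM act d F K)%E.
Proof. by move=> cK xK; apply: ereal_inf_lbound; exists K. Qed.

Lemma mdim_loc_le (x : X) : (mdim_loc act d F x <= mdimM act d F [set: X])%E.
Proof. by apply: mdim_loc_le_nbhs; [exact: closedT|exact: filterT]. Qed.

(** A closed neighbourhood of [x] is a neighbourhood of each point of its interior, so it bounds the
    local value there too. This upper semicontinuity also yields Borel measurability. *)
Lemma open_mdim_loc_lt (c : \bar R) : open [set x | (mdim_loc act d F x < c)%E].
Proof.
rewrite openE => x /ereal_inf_lt[_ [K [cK xK] <-] Kc].
have := nbhs_interior xK; apply: filterS => y yK; apply: le_lt_trans Kc.
by apply: mdim_loc_le_nbhs.
Qed.

Lemma measurable_mdim_loc :
  measurable_fun [set: borel X] (mdim_loc act d F : borel X -> \bar R).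
Proof.
apply: (measurability _ (ErealGenInftyO.measurableE R)).
move=> /= _ [_ [a ->]] <-; apply: measurableI => //; apply: sub_sigma_algebra.
by rewrite preimage_itvNyo; exact: open_mdim_loc_lt.
Qed.

Lemma exists_mdim_loc_ge :
  exists x : X, (mdimM act d F [set: X] <= mdim_loc act d F x)%E.
Proof.
set D := mdimM act d F [set: X]; apply: contrapT => /forallNP far.
have /choice[K hK] : forall x : X, exists K : set X,
    [/\ closed K, nbhs x K & (mdimM act d F K < D)%E].
  move=> x; have /negP := far x; rewrite -ltNge.
  by move=> /ereal_inf_lt[_ [K [cK xK] <-] KD]; exists K.
have D0 : (0 <= D)%E by apply: mdimM_ge0; exists point.
(* Each union raises the growth bound slightly, so the induction carries a real bound strictly below
   [D], which leaves room for the next step. *)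
have fin_union (s : seq X) : exists2 c : R, (c%:E < D)%E &
    sep_growth_le act d F (\bigcup_(x in [set` s]) K x) c.
  elim: s => [|x s [c1 c1D h1]].
    (* Any real bounds the growth of the empty union; a negative one is below [D] even if [D] is
       0. *)
    exists (-1); first by rewrite (lt_le_trans _ D0)// lte_fin ltrN10.
    exists 1 => // e _; apply: nearW => n E E0 _.
    have -> : E = fset0.
      by apply/eqP; rewrite -fsubset0; apply/fsubsetP => y /E0[].
    by rewrite cardfs0 expR_ge0.
  have [cK xK KD] := hK x.
  have [c2 Kc2 c2D] := ereal_real_between _ _ _ (mdimM_ge0 _ (nbhs_neq0 _ _ xK)) KD.
  have h2 := sep_growth_of_mdimM _ _ _ F0 _ _ (nbhs_neq0 _ _ xK) Kc2.
  have c20 : (0 <= c2%:E)%E.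
    by apply: le_trans (ltW Kc2); apply: mdimM_ge0; exact: nbhs_neq0 xK.
  pose c := Num.max c1 c2.
  have cD : (c%:E < D)%E by rewrite /c EFin_max gt_max c1D.
  have c0 : (0 <= c%:E)%E by rewrite (le_trans c20)// lee_fin le_max lexx orbT.
  have [c' cc' c'D] := ereal_real_between _ _ _ c0 cD.
  exists c' => //; rewrite (_ : \bigcup_(_ in _) _ = K x `|` \bigcup_(y in [set` s]) K y).
    rewrite lte_fin in cc'; apply: (sep_growthU _ _ _ F0 _ _ c) => //.
      by apply: sep_growth_weaken h2; rewrite le_max lexx orbT.
    by apply: sep_growth_weaken h1; rewrite le_max lexx.
  rewrite eqEsubset; split=> y.
    by move=> [z /=]; rewrite inE => /orP[/eqP -> ?|zs Kz]; [left|right; exists z].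
  move=> [Ky|[z zs Kz]]; first by exists x => //=; rewrite mem_head.
  by exists z => //=; rewrite inE zs orbT.
move: (cX); rewrite compact_cover => /(_ X setT (fun x => (K x)°)) [].
- by move=> x _; exact: open_interior.
- by move=> x _; exists x => //; have [_ xK _] := hK x.
move=> S _ XS; have [c cD h] := fin_union S.
have KT : \bigcup_(x in [set` enum_fset S]) K x = setT.
  by rewrite -subTset => x /XS[y yS /interior_subset Ky]; exists y.
rewrite KT in h; have /le_lt_trans/(_ cD) := mdimM_of_sep_growth _ _ _ F0 _ _
  (ex_intro _ point I : [set: X] !=set0) h.
by rewrite ltxx.
Qed.

(** A closed neighbourhood [K] of [act g x] pulls back to one of [x]. Were its value larger than
    that of [K], two reals in the gap would contradict [sep_growth_preimage]. *)
Lemma mdim_loc_act_ge (mul : G -> G -> G) (g : G) (c : \bar R) (x : X) :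
  metric_for d -> (forall g h x, act (mul g h) x = act g (act h x)) ->
  two_sided_Folner (R := R) mul F -> injective (act g) -> continuous (act g) ->
  (c <= mdim_loc act d F x)%E -> (c <= mdim_loc act d F (act g x))%E.
Proof.
move=> md actM FF gI gc /le_trans; apply.
apply: le_ereal_inf_tmp => _ [K [cK gxK] <-].
pose K' := act g @^-1` K.
have xK' : nbhs x K' by exact: gc.
apply: (@le_trans _ _ (mdimM act d F K')).
  by apply: mdim_loc_le_nbhs => //; apply: preimage_closed => // y _; exact: gc.
rewrite leNgt; apply/negP => lt.
have K0 := nbhs_neq0 _ _ gxK.
have [r1 Kr1 r1K'] := ereal_real_between _ _ _ (mdimM_ge0 _ K0) lt.
have r10 : (0 <= r1%:E)%E by apply: le_trans (ltW Kr1); exact: mdimM_ge0.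
have [r2 r12 r2K'] := ereal_real_between _ _ _ r10 r1K'.
rewrite lte_fin in r12.
have h1 := sep_growth_of_mdimM _ _ _ F0 _ _ K0 Kr1.
have h2 := sep_growth_preimage _ _ _ _ _ _ _ _ _ _ _ cX md actM FF gI r12 h1.
have := mdimM_of_sep_growth _ _ _ F0 _ _ (nbhs_neq0 _ _ xK') h2.
by rewrite leNgt r2K'.
Qed.

End LocalMeanDimension.

(** * Maximizing points and measures *)

Lemma metric_for_hausdorff (R : realType) (X : pseudoPMetricType R) (d : X -> X -> R) :
  metric_for d -> hausdorff_space X.
Proof.
move=> md p q pq; have [d0 dC dT dball] := md; apply/d0/eqP.
rewrite eq_le metric_for_ge0// andbT; apply/ler_addgt0Pr => e e0; rewrite add0r.
have e20 : 0 < e / 2 by rewrite divr_gt0.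
have [z []] := pq _ _ (nbhsx_ballx p _ e20) (nbhsx_ballx q _ e20).
rewrite !dball//= => pz qz; rewrite (splitr e).
by apply: le_trans (dT _ z _) _; rewrite lerD// ltW// dC.
Qed.

Theorem theorem1p4 (R : realType) (G : countType)
  (mul : G -> G -> G) (one : G) (inv : G -> G)
  (X : pseudoPMetricType R) (d : X -> X -> R) (act : G -> X -> X)
  (F : nat -> {fset G}) :
  is_group mul one inv -> infinite_set [set: G] ->
  compact [set: X] -> metric_for d ->
  is_action mul one act -> (forall g, continuous (act g)) ->
  two_sided_Folner (R := R) mul F -> tempered (R := R) mul inv F ->
  let D := mdimM act d F [set: X] in
  ((exists x : X, mdim_loc act d F x = D) /\
   (forall x : X, (mdim_loc act d F x <= D)%E)) /\
  ((exists mu : probability (borel X) R,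
      invariant_measure act mu /\ (\int[mu]_x mdim_loc act d F x)%E = D) /\
   (forall mu : probability (borel X) R,
      invariant_measure act mu -> ((\int[mu]_x mdim_loc act d F x) <= D)%E)).
Proof.
move=> grp _ cX md action actc FF _ D.
have [[F0 Finv] _] := FF; have [_ actM] := action.
have actK := act_inv_cancel _ _ _ _ _ _ grp action.
have [x0 x0D] := exists_mdim_loc_ge act d F F0 cX.
have locD x : (mdim_loc act d F x <= D)%E := mdim_loc_le act d F x.
have mloc := measurable_mdim_loc act d F.
have loc0 := mdim_loc_ge0 act d F F0.
have D0 : (0 <= D)%E := le_trans (loc0 x0) (locD x0).
split; first by split=> //; exists x0; apply/eqP; rewrite eq_le locD.
have intD (mu : probability (borel X) R) (c : \bar R) : (\int[mu]_x c = c)%E.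
  rewrite -[RHS]mule1 -(probability_setT mu); exact: integral_cst.
split; last first.
  by move=> mu _; rewrite -[leRHS](intD mu D); exact: ge0_le_integral.
have mulI h : injective (mul h).
  have [mulA mul1 mulV] := grp; move=> a b /(congr1 (mul (inv h))).
  by rewrite !mulA mulV !mul1.
have [m [mm minv m1]] := folner_invariant_finadd _ _ _ _ _ _ x0 (conj F0 Finv) mulI actM.
have nX := (@normal_openP R _).1 (compact_normal (metric_for_hausdorff _ _ _ md) cX).
have [mu muE] := outer_content_measure _ _ _ mm nX cX.
exists mu; split.
  move=> g A mA; rewrite !muE; have [gK Kg] := actK g.
  exact: (outer_content_preimage _ _ _ _ _ (actc g) (actc (inv g)) gK Kg (minv g)).
(* Since the local value never exceeds [D], it suffices that the open set [N] where it is smaller is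
   null. *)
rewrite -[RHS](intD mu D); apply: ge0_ae_eq_integral => //.
pose N : set X := [set x | (mdim_loc act d F x < D)%E].
have oN : open N by exact: open_mdim_loc_lt.
(* The whole orbit of [x0] has local value at least [D], so the complement of [N] has mass 1 under
   [m]. *)
have mN0 : m N = 0.
  have [_ mU mT] := mm; have : m N + m (~` N) = 1.
    by rewrite -mU ?setUv// setICr.
  rewrite (m1 (~` N)); first by move/eqP; rewrite -subr_eq0 addrK => /eqP.
  move=> g; rewrite /N /=; apply/negP; rewrite -leNgt.
  apply: (mdim_loc_act_ge _ _ _ F0 cX mul) => //.
  exact: can_inj (actK g).1.
exists N; split.
- exact: sub_sigma_algebra.
(* On the open set [N] the measure is a supremum of values [m K] with [K] inside [N], all at most
   [m N]. *)
- apply: (eq_trans (muE N)); rewrite outer_content_open//; apply/eqP.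
  rewrite eq_le inner_content_ge0// andbT; apply: ge_ereal_sup => _ [K [cK KN] <-].
  by rewrite lee_fin -mN0; exact: finadd_le.
- move=> x /= /not_implyP[_ xD]; rewrite /N /= lt_neqAle locD andbT.
  exact/eqP.
Qed.
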